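(* Let $G$ be a connected $P_3\cup P_1$-free graph. Then $cop(G)\leq 2$.
   Context: All graphs are finite, simple and undirected. $P_n$ denotes the path on $n$ vertices; $G\cup H$ denotes the disjoint union of vertex-disjoint graphs, so $P_3\cup P_1$ is a path on three vertices plus an isolated vertex. A graph is $H$-free if it contains no induced subgraph isomorphic to $H$. Game of cops and robber on a connected graph: first all cops are placed on vertices (several may share a vertex), then the robber chooses a vertex; afterwards cops and robber move alternately, starting with the cops, a move consisting of staying put or moving to an adjacent vertex. The cops win if after finitely many rounds some cop is on the same vertex as the robber. The cop number $cop(G)$ is the minimum number of cops that guarantees a win in each connected component of $G$. *)

(* Defs.v *)
From mathcomp Require Import all_boot.
From mathcomp Require Import boolp.

Set Implicit Arguments.
Unset Strict Implicit.
Unset Printing Implicit Defensive.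

Record sgraph := SGraph {
  vertex :> finType;
  adj : rel vertex;
  adj_sym : symmetric adj;
  adj_irrefl : irreflexive adj }.

Definition graph_iso (G H : sgraph) : Prop :=
  exists2 f : G -> H, bijective f & forall x y : G, adj (f x) (f y) = adj x y.

Section Induced.
Variables (G : sgraph) (S : {set G}).

Definition induced_adj : rel {x : G | x \in S} :=
  fun x y => adj (val x) (val y).

Fact induced_adj_sym : symmetric induced_adj.
Proof. by move=> x y; exact: adj_sym. Qed.

Fact induced_adj_irrefl : irreflexive induced_adj.
Proof. by move=> x; exact: adj_irrefl. Qed.

Definition induced : sgraph := SGraph induced_adj_sym induced_adj_irrefl.
End Induced.

Definition free_of (H G : sgraph) : Prop :=
  ~ exists S : {set G}, graph_iso (induced S) H.

Section PathGraph.
Variable n : nat.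

Definition path_adj : rel 'I_n :=
  fun i j => (i.+1 == j :> nat) || (j.+1 == i :> nat).

Fact path_adj_sym : symmetric path_adj.
Proof. by move=> i j; rewrite /path_adj orbC. Qed.

Fact path_adj_irrefl : irreflexive path_adj.
Proof. by move=> i; rewrite /path_adj orbb; apply/negbTE; rewrite neq_ltn ltnSn orbT. Qed.

Definition path_graph : sgraph := SGraph path_adj_sym path_adj_irrefl.
End PathGraph.

Section DisjointUnion.
Variables G H : sgraph.

Definition disjoint_union_adj : rel (G + H)%type := fun u v =>
  match u, v with
  | inl x, inl y => adj x y
  | inr x, inr y => adj x y
  | _, _ => false
  end.

Fact disjoint_union_adj_sym : symmetric disjoint_union_adj.
Proof. by move=> [x|x] [y|y] //=; exact: adj_sym. Qed.

Fact disjoint_union_adj_irrefl : irreflexive disjoint_union_adj.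
Proof. by move=> [x|x] /=; exact: adj_irrefl. Qed.

Definition disjoint_union : sgraph :=
  SGraph disjoint_union_adj_sym disjoint_union_adj_irrefl.
End DisjointUnion.

(* The graph without vertices satisfies this too; its cop number is 0. *)
Definition connected_graph (G : sgraph) : Prop :=
  forall x y : G, connect (@adj G) x y.

Definition component (G : sgraph) (x : G) : sgraph :=
  induced [set y | connect (@adj G) x y].

Section Game.
Variables (G : sgraph) (k : nat).

Definition legal_move (x y : G) : bool := (x == y) || adj x y.

Definition legal_robber (r : nat -> G) : Prop :=
  forall n, legal_move (r n) (r n.+1).

(* A strategy maps the robber positions [:: r 0; ...; r n.-1] seen so far to
   the positions of the k cops after their n-th move; its value at [::] is the
   initial placement. *)
Definition cop_strategy := seq G -> {ffun 'I_k -> G}.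

Definition cops_at (s : cop_strategy) (r : nat -> G) (n : nat) :=
  s (mkseq r n).

Definition legal_cops (s : cop_strategy) : Prop :=
  forall r, legal_robber r ->
  forall n i, legal_move (cops_at s r n i) (cops_at s r n.+1 i).

(* The positions occur in the order
   cops_at 0, r 0, cops_at 1, r 1, cops_at 2, ...
   so the robber standing at r n can be caught either on his arrival there or
   by the cops' next move. *)
Definition captured (s : cop_strategy) (r : nat -> G) : Prop :=
  exists n i, cops_at s r n i = r n \/ cops_at s r n.+1 i = r n.

Definition cops_win : Prop :=
  exists2 s : cop_strategy, legal_cops s &
    forall r, legal_robber r -> captured s r.
End Game.

Definition cops_suffice (G : sgraph) (k : nat) : Prop :=
  forall x : G, cops_win (component x) k.

Fact cops_suffice_exists (G : sgraph) : exists k, `[< cops_suffice G k >].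
Proof.
exists #|G|; apply/asboolP => x.
pose H := component x.
have x_in : x \in [set y | connect (@adj G) x y] by rewrite inE connect0.
pose x0 : H := exist _ x x_in.
exists (fun=> [ffun i : 'I_#|G| => nth x0 (enum H) i]).
  by move=> r _ n i; rewrite /legal_move /cops_at eqxx.
move=> r _; exists 0.
have lt_r : index (r 0) (enum H) < #|G|.
  have lt_H : index (r 0) (enum H) < #|H|.
    by rewrite cardE index_mem mem_enum.
  apply: leq_trans lt_H _; apply: leq_card val_inj.
exists (Ordinal lt_r); left.
by rewrite /cops_at ffunE /= nth_index // mem_enum.
Qed.

Definition cop_number (G : sgraph) : nat := ex_minn (cops_suffice_exists G).

(* Main.v *)
Require Import Defs.
From mathcomp Require Import all_boot.
From mathcomp Require Import boolp.

(** The graph has a dominating pair, on which the two cops start and from which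
    they capture at once. If [a], [b] are distinct and non-adjacent and do not
    dominate, there is an independent triple [a], [b], [c]. In a
    (P_3 + P_1)-free graph every induced P_3 dominates, so a vertex adjacent to
    two members of the triple is adjacent to the third. If some [w] is adjacent
    to all three, then [a], [w] dominate. Otherwise every vertex is adjacent to
    at most one of them, and then a vertex at distance two from [a] yields an
    induced P_3 missing [b] or [c]; so the closed neighbourhood of [a] is a
    component avoiding [b], against connectedness. *)

Set Implicit Arguments.
Unset Strict Implicit.
Unset Printing Implicit Defensive.

(** The image of [g] carries the forbidden copy. [free_of] wants the isomorphism from the induced
    subgraph to [H], hence the inverse of [h]. *)
Lemma free_of_no_embedding (H G : sgraph) (g : H -> G) :
  injective g -> (forall x y, adj (g x) (g y) = adj x y) -> ~ free_of H G.
Proof.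
move=> g_inj g_adj; apply; exists [set g x | x in H].
have g_in x : g x \in [set g x | x in H] by apply: imset_f.
pose h x : induced [set g x | x in H] := exist _ (g x) (g_in x).
have h_bij : bijective h.
  apply: inj_card_bij => [x y /(congr1 val) /g_inj //|].
  rewrite card_sig -(card_imset _ g_inj); apply: subset_leq_card.
  by apply/subsetP => x; rewrite inE.
have [f hK fK] := h_bij.
exists f; first by exists h.
by move=> u v; rewrite -g_adj -[in RHS](fK u) -[in RHS](fK v).
Qed.

Lemma legal_move_sym (G : sgraph) : symmetric (@legal_move G).
Proof. by move=> x y; rewrite /legal_move eq_sym adj_sym. Qed.

(** Otherwise the induced path [a], [x], [y] together with the isolated vertex [z] is a forbidden
    subgraph. *)
Lemma induced_P3_dominates (G : sgraph) (a x y z : G) :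
  free_of (disjoint_union (path_graph 3) (path_graph 1)) G ->
  adj a x -> adj x y -> ~~ legal_move a y ->
  [|| legal_move a z, legal_move x z | legal_move y z].
Proof.
move=> Gfree ax xy /norP[nay ay]; apply/negPn/negP.
case/norP=> /norP[naz az] /norP[/norP[nxz xz] /norP[nyz yz]].
have nax : a != x by apply: contraTneq ax => ->; rewrite adj_irrefl.
have nxy : x != y by apply: contraTneq xy => ->; rewrite adj_irrefl.
pose g (u : disjoint_union (path_graph 3) (path_graph 1)) : G :=
  match u with inl i => nth z [:: a; x; y] i | inr _ => z end.
apply: (@free_of_no_embedding _ _ g) Gfree.
- have z_notin : z \notin [:: a; x; y].
    by rewrite !inE !negb_or ![z == _]eq_sym naz nxz nyz.
  have z_neq (i : 'I_3) : nth z [:: a; x; y] i = z -> False.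
    by move=> iz; move: z_notin; rewrite -{1}iz mem_nth.
  move=> [i|i] [j|j] /=.
  + move/eqP; rewrite nth_uniq //= ?inE ?negb_or ?nax ?nay ?nxy //.
    by move/eqP/val_inj=> ->.
  + by move/z_neq.
  + by move/esym/z_neq.
  + by rewrite (ord1 i) (ord1 j).
have edges := (ax, xy, negbTE ay, negbTE az, negbTE xz, negbTE yz).
by move=> [[[|[|[|i]]] // lti]|i] [[[|[|[|j]]] // ltj]|j] //=;
  rewrite ?(ord1 i) ?(ord1 j) ?adj_irrefl ?edges // adj_sym edges.
Qed.

Definition dominating_pair (G : sgraph) (u v : G) : Prop :=
  forall z, legal_move u z || legal_move v z.

Lemma legal_adj (G : sgraph) (x y : G) : adj x y -> legal_move x y.
Proof. by rewrite /legal_move orbC => ->. Qed.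

Lemma adj_legal (G : sgraph) (x y : G) : legal_move x y -> x != y -> adj x y.
Proof. by rewrite /legal_move => /orP[->|]. Qed.

Section IndependentTriple.
Variables (G : sgraph) (a b c : G).
Hypothesis Gfree : free_of (disjoint_union (path_graph 3) (path_graph 1)) G.
Hypotheses (ab : ~~ legal_move a b) (ac : ~~ legal_move a c)
  (bc : ~~ legal_move b c).

(** The induced path [a], [w], [b] dominates [c], and only [w] can do so. *)
Lemma independent_triple_adj w : adj a w -> adj w b -> adj w c.
Proof.
move=> aw wb; have := induced_P3_dominates c Gfree aw wb ab.
rewrite (negbTE ac) (negbTE bc) orbF => /= /adj_legal; apply.
by apply: contraNneq ac => <-; apply: legal_adj.
Qed.
End IndependentTriple.

Section DominatingPair.
Variable G : sgraph.
Hypothesis Gconn : connected_graph G.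
Hypothesis Gfree : free_of (disjoint_union (path_graph 3) (path_graph 1)) G.

Lemma common_neighbour_dominates (a b c w : G) :
  ~~ legal_move a b -> ~~ legal_move a c -> ~~ legal_move b c ->
  adj a w -> adj w b -> adj w c -> dominating_pair a w.
Proof.
move=> ab ac bc aw wb wc z; apply/negPn/negP => /norP[az wz].
(* The induced paths [a], [w], [b] and [a], [w], [c] both dominate [z], so [z] is a neighbour of [b]
   and [c], hence of [a]. *)
have bz : legal_move b z.
  have := induced_P3_dominates z Gfree aw wb ab.
  by rewrite (negbTE az) (negbTE wz).
have cz : legal_move c z.
  have := induced_P3_dominates z Gfree aw wc ac.
  by rewrite (negbTE az) (negbTE wz).
have abz : adj b z.
  by apply: adj_legal bz _; apply: contraNneq wz => <-; apply: legal_adj.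
have acz : adj c z.
  by apply: adj_legal cz _; apply: contraNneq wz => <-; apply: legal_adj.
case/negP: az; rewrite legal_move_sym; apply: legal_adj.
apply: (@independent_triple_adj _ b c a Gfree) => //.
- by rewrite legal_move_sym.
- by rewrite legal_move_sym.
- by rewrite adj_sym.
Qed.

Lemma independent_triple_common_neighbour (a b c : G) :
  ~~ legal_move a b -> ~~ legal_move a c -> ~~ legal_move b c ->
  exists w, [/\ adj a w, adj w b & adj w c].
Proof.
move=> ab ac bc.
have [/existsP[w /and3P[*]]|] :=
  boolP [exists w, [&& adj a w, adj w b & adj w c]]; first by exists w.
rewrite negb_exists => /forallP no_w.
have cb : ~~ legal_move c b by rewrite legal_move_sym.
have nb w : adj a w -> ~~ adj w b.
  move=> aw; apply/negP=> wb; move: (no_w w).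
  by rewrite aw wb (independent_triple_adj Gfree ab ac bc aw wb).
have nc w : adj a w -> ~~ adj w c.
  move=> aw; apply/negP=> wc; move: (no_w w).
  by rewrite aw wc (independent_triple_adj Gfree ac ab cb aw wc).
(* By connectedness a closed set containing [a] would contain [b]. *)
suff closed_a : closed (@adj G) [pred y | legal_move a y].
  have := closed_connect closed_a (Gconn a b).
  by rewrite !inE (negbTE ab) /legal_move eqxx.
apply: intro_closed => [|x y xy]; first exact/sym_connect_sym/adj_sym.
rewrite !inE => ax; apply/negPn/negP => nay.
have {}ax : adj a x.
  by apply: adj_legal ax _; apply: contraNneq nay => ->; apply: legal_adj.
(* Applied to [b] and [c], this makes [y] adjacent to two members of the triple, hence to [a]. *)
have dominated d : ~~ legal_move a d -> ~~ adj x d -> adj y d.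
  move=> ad xd; have := induced_P3_dominates d Gfree ax xy nay.
  have nxd : x != d by apply: contraNneq ad => <-; apply: legal_adj.
  have nyd : y != d by apply: contraNneq xd => <-.
  by rewrite (negbTE ad) {1}/legal_move (negbTE nxd) (negbTE xd) => /adj_legal->.
have yb := dominated b ab (nb x ax); have yc := dominated c ac (nc x ax).
case/negP: nay; rewrite legal_move_sym; apply: legal_adj.
apply: (@independent_triple_adj _ b c a Gfree) => //.
- by rewrite legal_move_sym.
- by rewrite legal_move_sym.
- by rewrite adj_sym.
Qed.

Lemma exists_dominating_pair (x0 : G) : exists u v : G, dominating_pair u v.
Proof.
have [/forallP x0_dom|] := boolP [forall b, legal_move x0 b].
  by exists x0, x0 => z; rewrite x0_dom.
rewrite negb_forall => /existsP[b ab].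
have [/forallP dom|] := boolP [forall c, legal_move x0 c || legal_move b c].
  by exists x0, b.
rewrite negb_forall => /existsP[c /norP[ac bc]].
have [w [aw wb wc]] := independent_triple_common_neighbour ab ac bc.
by exists x0, w; apply: common_neighbour_dominates ab ac bc aw wb wc.
Qed.
End DominatingPair.

Lemma dominating_pair_cops_win (G : sgraph) (u v : G) :
  dominating_pair u v -> cops_win G 2.
Proof.
move=> uv_dom.
pose start (i : 'I_2) := if i == ord0 then u else v.
(* Only the robber's first position is read: every cop who can reach it steps there, and afterwards
   nobody moves. *)
pose s : cop_strategy G 2 := fun p => [ffun i =>
  if ohead p is Some r0 then
    if legal_move (start i) r0 then r0 else start i
  else start i].
exists s => [r _ [|n] i|r _].
- rewrite /cops_at !ffunE /=; case: ifP => // _.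
  by rewrite /legal_move eqxx.
- by rewrite /cops_at !ffunE /= /legal_move eqxx.
exists 0.
have [i catch] : exists i, legal_move (start i) (r 0).
  by case/orP: (uv_dom (r 0)) => ?; [exists ord0|exists ord_max].
by exists i; right; rewrite /cops_at ffunE /= catch.
Qed.

Theorem theorem5p1 (G : sgraph) :
  connected_graph G ->
  free_of (disjoint_union (path_graph 3) (path_graph 1)) G ->
  cop_number G <= 2.
Proof.
move=> Gconn Gfree; rewrite /cop_number; case: ex_minnP => m _; apply.
apply/asboolP => x.
have [u [v uv_dom]] := exists_dominating_pair Gconn Gfree x.
(* The component is all of [G] but a different type, so the pair is lifted to it. *)
have in_comp y : y \in [set y | connect (@adj G) x y] by rewrite inE.
apply: (@dominating_pair_cops_win (component x)
  (exist _ u (in_comp u)) (exist _ v (in_comp v))) => z.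
exact: uv_dom (val z).
Qed.
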